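(* For every $\Gamma\cup\{\phi\}\subseteq\mathcal{L}_{\Box\Diamond}$: $\Gamma\Vdash^{\mathrm{inm}}\phi$ if and only if $\Gamma\Vdash^{\mathrm{coh}}\phi$.
   Context: $\mathcal{L}_{\Box\Diamond}$: formulas $\phi ::= p_i \mid \bot \mid \phi\wedge\phi \mid \phi\vee\phi \mid \phi\to\phi \mid \Box\phi \mid \Diamond\phi$ over a countable set of proposition letters $p_i$. Intuitionistic neighbourhood models: for a poset $(W,\le)$, an intuitionistic neighbourhood is a partial function $a:W\rightharpoonup\mathcal{P}(W)$ whose domain $\mathrm{dom}(a)$ is an upset. A model is $\mathcal{M}=(W,\le,N,V)$ with $N$ a set of intuitionistic neighbourhoods and $V$ mapping proposition letters to upsets; $N_w=\{a\in N\mid w\in\mathrm{dom}(a)\}$. Truth: $w\Vdash p$ iff $w\in V(p)$; $\bot$ never; $\wedge,\vee$ pointwise; $w\Vdash\phi\to\psi$ iff for all $v\ge w$, $v\Vdash\phi$ implies $v\Vdash\psi$; $w\Vdash\Box\phi$ iff there is $a\in N_w$ such that for all $w'\ge w$ and all $v\in a(w')$, $v\Vdash\phi$; $w\Vdash\Diamond\phi$ iff for all $w'\ge w$ and all $a\in N_{w'}$ there is $v\in a(w')$ with $v\Vdash\phi$. $\Gamma\Vdash^{\mathrm{inm}}\phi$: in every such model, every world satisfying all of $\Gamma$ satisfies $\phi$. An intuitionistic neighbourhood $a$ is coherent if (N1) whenever $w\le w'$ (with $w,w'\in\mathrm{dom}(a)$) and $v\in a(w)$, there is $v'\in a(w')$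 with $v\le v'$; and (N2) whenever $v\in a(w)$ and $v\le v'$, there is $w'\ge w$ with $v'\in a(w')$. A model is coherent if all its neighbourhoods are. $\Gamma\Vdash^{\mathrm{coh}}\phi$: in every coherent model, every world satisfying all of $\Gamma$ satisfies $\phi$. *)

(* Defs.v *)
From Stdlib Require Import Ensembles Relation_Definitions.

Set Implicit Arguments.

Inductive formula : Type :=
| Var (i : nat)
| Bot
| And (phi psi : formula)
| Or (phi psi : formula)
| Imp (phi psi : formula)
| Box (phi : formula)
| Dia (phi : formula).

Definition upset (W : Type) (le : relation W) (U : Ensemble W) : Prop :=
  forall w w', le w w' -> In W U w -> In W U w'.

(* Partial functions from W to the powerset of W; [None] means undefined,
   which differs from [Some (Empty_set W)]. *)
Definition pfun (W : Type) : Type := W -> option (Ensemble W).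

Definition dom (W : Type) (a : pfun W) : Ensemble W := fun w => a w <> None.

(* [mem_at a w v]: a is defined at w and v belongs to a(w). *)
Definition mem_at (W : Type) (a : pfun W) (w v : W) : Prop :=
  exists X, a w = Some X /\ In W X v.

Definition is_nbhd (W : Type) (le : relation W) (a : pfun W) : Prop :=
  upset le (dom a).

Record model : Type := Model {
  world : Type;
  le : relation world;
  le_order : order world le;
  nbhds : Ensemble (pfun world);
  nbhds_ok : forall a, In _ nbhds a -> is_nbhd le a;
  val : nat -> Ensemble world;
  val_upset : forall i, upset le (val i)
}.

Definition nbhds_at (M : model) (w : world M) : Ensemble (pfun (world M)) :=
  fun a => In _ (nbhds M) a /\ In _ (dom a) w.

Fixpoint forces (M : model) (w : world M) (phi : formula) : Prop :=
  match phi with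
  | Var i => In _ (val M i) w
  | Bot => False
  | And phi psi => forces M w phi /\ forces M w psi
  | Or phi psi => forces M w phi \/ forces M w psi
  | Imp phi psi => forall v, le M w v -> forces M v phi -> forces M v psi
  | Box phi =>
      exists a, In _ (nbhds_at M w) a /\
        forall w', le M w w' -> forall v, mem_at a w' v -> forces M v phi
  | Dia phi =>
      forall w', le M w w' -> forall a, In _ (nbhds_at M w') a ->
        exists v, mem_at a w' v /\ forces M v phi
  end.

Definition N1 (W : Type) (le : relation W) (a : pfun W) : Prop :=
  forall w w' v, In W (dom a) w -> In W (dom a) w' -> le w w' ->
    mem_at a w v -> exists v', mem_at a w' v' /\ le v v'.

Definition N2 (W : Type) (le : relation W) (a : pfun W) : Prop :=
  forall w v v', mem_at a w v -> le v v' ->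
    exists w', le w w' /\ mem_at a w' v'.

Definition coherent_nbhd (W : Type) (le : relation W) (a : pfun W) : Prop :=
  N1 le a /\ N2 le a.

Definition coherent (M : model) : Prop :=
  forall a, In _ (nbhds M) a -> coherent_nbhd (le M) a.

Definition conseq_on (C : model -> Prop) (Gamma : Ensemble formula)
    (phi : formula) : Prop :=
  forall M, C M -> forall w : world M,
    (forall psi, In _ Gamma psi -> forces M w psi) -> forces M w phi.

Definition inm_conseq : Ensemble formula -> formula -> Prop :=
  conseq_on (fun _ => True).

Definition coh_conseq : Ensemble formula -> formula -> Prop :=
  conseq_on coherent.

(* Main.v *)
(** A model M is made coherent without changing its theory as follows.  Worlds
    are pairs (w, n) with n a natural number, ordered componentwise; the
    counter is invisible to valuations.  Every neighbourhood a and every world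
    (w0, n0) with w0 in dom(a) yield a neighbourhood with domain the cone above
    (w0, n0): its value at (u, n) is the union of the sets a(t) for
    w0 <= t <= u if n = n0, and the upward closure of that union if n > n0.
    The values grow along the order, which gives (N1), and increasing the
    counter closes upwards, which gives (N2).  The value at (u, n) contains
    a(u), its elements all lie above elements of a(t) with t >= w0, and at the
    apex (w0, n0) it is exactly a(w0); so [Box] and [Dia] are unaffected. *)

Require Import Defs.
From Stdlib Require Import Ensembles.
From Stdlib Require Import Relation_Definitions ClassicalEpsilon PeanoNat Lia.

(** [Imp] and [Dia] quantify over all later worlds, and for [Box] the same neighbourhood serves
    later, its domain being an upset. *)
Lemma forces_persistent (M : model) (phi : formula) (w w' : world M) :
  le M w w' -> forces M w phi -> forces M w' phi.
Proof.
  destruct (le_order M) as [_ trans _].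
  revert w w'; induction phi as [i| |p IHp q IHq|p IHp q IHq|p _ q _|p _|p _];
    simpl; intros w w' Hw.
  - exact (@val_upset M i w w' Hw).
  - tauto.
  - intros [Hp Hq]; eauto.
  - intros [Hp|Hq]; eauto.
  - intros H v Hv; apply H; eauto.
  - intros [a [[Ha Hdom] H]]; exists a; split.
    + split; [exact Ha | exact (@nbhds_ok M a Ha w w' Hw Hdom)].
    + intros u Hu; apply H; eauto.
  - intros H u Hu; apply H; eauto.
Qed.

(** Definedness is a computed [option], so an arbitrary domain has to be decided classically. *)
Definition restrict {W : Type} (D : Ensemble W) (F : W -> Ensemble W) : pfun W :=
  fun w => if excluded_middle_informative (In W D w) then Some (F w) else None.

Lemma dom_restrict {W : Type} (D : Ensemble W) (F : W -> Ensemble W) (w : W) :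
  In W (dom (restrict D F)) w <-> In W D w.
Proof.
  unfold In at 1, dom, restrict.
  destruct (excluded_middle_informative _); split; intuition discriminate.
Qed.

Lemma mem_at_restrict {W : Type} (D : Ensemble W) (F : W -> Ensemble W) (w v : W) :
  mem_at (restrict D F) w v <-> In W D w /\ In W (F w) v.
Proof.
  unfold mem_at, restrict.
  destruct (excluded_middle_informative _) as [H|H]; split.
  - intros [X [E HX]]; injection E as <-; tauto.
  - intros [_ HF]; eauto.
  - intros [X [E _]]; discriminate.
  - tauto.
Qed.

Section Unravelling.

Variable M : model.

Definition counted_world : Type := (world M * nat)%type.

Definition counted_le : relation counted_world :=
  fun x y => le M (fst x) (fst y) /\ snd x <= snd y.

Lemma counted_le_order : order counted_world counted_le.
Proof.
  destruct (le_order M) as [refl trans antisym]; split.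
  - intros x; split; [apply refl | apply Nat.le_refl].
  - intros x y z [Hxy Nxy] [Hyz Nyz]; split; [eapply trans; eauto | lia].
  - intros [x m] [y n] [Hxy Nxy] [Hyx Nyx]; simpl in *; f_equal.
    + apply antisym; assumption.
    + lia.
Qed.

(** The counter of [v] is left free: a value contains all copies of a world of [M] or none. *)
Definition cone_value (a : pfun (world M)) (r x : counted_world) :
    Ensemble counted_world :=
  fun v => exists t s, le M (fst r) t /\ le M t (fst x) /\ mem_at a t s /\
    (fst v = s \/ snd r < snd x /\ le M s (fst v)).

Definition cone_nbhd (a : pfun (world M)) (r : counted_world) :
    pfun counted_world :=
  restrict (counted_le r) (cone_value a r).

Definition cone_nbhds : Ensemble (pfun counted_world) :=
  fun b => exists a r, In _ (nbhds_at M (fst r)) a /\ b = cone_nbhd a r.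

Lemma cone_nbhd_ok (b : pfun counted_world) :
  In _ cone_nbhds b -> is_nbhd counted_le b.
Proof.
  destruct counted_le_order as [_ trans _].
  intros [a [r [_ ->]]] x y Hxy Hx.
  apply dom_restrict; apply dom_restrict in Hx.
  exact (trans _ _ _ Hx Hxy).
Qed.

Lemma counted_val_upset (i : nat) :
  upset counted_le (fun x => In _ (val M i) (fst x)).
Proof. intros x y [Hxy _]; exact (@val_upset M i _ _ Hxy). Qed.

Definition unravelling : model :=
  Model counted_le_order cone_nbhds cone_nbhd_ok
    (fun i x => In _ (val M i) (fst x)) counted_val_upset.

Lemma unravelling_coherent : coherent unravelling.
Proof.
  destruct (le_order M) as [refl trans _].
  intros b [a [r [_ ->]]]; split.
  - intros x y v _ Hy [Hxy Nxy] Hv.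
    apply mem_at_restrict in Hv as [_ [t [s (Hrt & Htx & Hs & Hv)]]].
    exists v; split; [apply mem_at_restrict; split|].
    + exact (proj1 (dom_restrict _ _ _) Hy).
    + exists t, s; repeat split; eauto.
      destruct Hv as [Hv|[N Hv]]; [tauto | right; split; [lia | exact Hv]].
    + exact (ord_refl _ _ counted_le_order v).
  - intros x v v' Hv [Hvv' _].
    apply mem_at_restrict in Hv as [[Hrx Nrx] [t [s (Hrt & Htx & Hs & Hv)]]].
    (* One tick puts the counter strictly above that of [r], where upward closure is in force. *)
    exists (fst x, S (snd x)); split; [split; simpl; auto|].
    apply mem_at_restrict; split; [split; simpl; auto|].
    exists t, s; repeat split; eauto.
    right; split; simpl; [lia|].
    destruct Hv as [<-|[_ Hv]]; eauto.
Qed.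

Lemma mem_at_cone_nbhd (a : pfun (world M)) (r x v : counted_world) :
  counted_le r x -> mem_at a (fst x) (fst v) -> mem_at (cone_nbhd a r) x v.
Proof.
  intros Hrx Hv; apply mem_at_restrict; split; [exact Hrx|].
  exists (fst x), (fst v); repeat split; auto.
  - exact (proj1 Hrx).
  - apply (ord_refl _ _ (le_order M)).
Qed.

(** At [r] the strict counter inequality fails, and antisymmetry leaves [t = fst r] as the only
    stage. *)
Lemma mem_at_cone_nbhd_apex (a : pfun (world M)) (r v : counted_world) :
  mem_at (cone_nbhd a r) r v -> mem_at a (fst r) (fst v).
Proof.
  intros Hv; apply mem_at_restrict in Hv as [_ [t [s (Hrt & Htr & Hs & Hv)]]].
  destruct Hv as [->|[N _]]; [|lia].
  rewrite (ord_antisym _ _ (le_order M) _ _ Hrt Htr); exact Hs.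
Qed.

Lemma forces_unravelling (phi : formula) (x : counted_world) :
  forces unravelling x phi <-> forces M (fst x) phi.
Proof.
  revert x; induction phi as [i| |p IHp q IHq|p IHp q IHq|p IHp q IHq|p IHp|p IHp];
    simpl; intros x.
  - reflexivity.
  - reflexivity.
  - rewrite IHp, IHq; reflexivity.
  - rewrite IHp, IHq; reflexivity.
  - split; intros H.
    + intros v Hv Hp; apply (IHq (v, snd x)), H.
      * split; simpl; auto.
      * apply IHp; exact Hp.
    + intros v [Hv _] Hp; apply IHq, H; [exact Hv|].
      apply IHp; exact Hp.
  - split.
    + intros [b [[[a [r [[Ha Hdom] ->]]] Hx] H]].
      apply dom_restrict in Hx.
      exists a; split.
      * split; [exact Ha | exact (@nbhds_ok M a Ha _ _ (proj1 Hx) Hdom)].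
      * intros u Hu v Hv; apply (IHp (v, 0)).
        assert (Hxu : counted_le x (u, snd x)) by (split; simpl; auto).
        apply (H (u, snd x) Hxu), mem_at_cone_nbhd; [|exact Hv].
        exact (ord_trans _ _ counted_le_order _ _ _ Hx Hxu).
    + intros [a [Ha H]].
      exists (cone_nbhd a x); split; [split|].
      * exists a, x; auto.
      * apply dom_restrict, (ord_refl _ _ counted_le_order).
      * intros y _ v Hv; apply IHp.
        apply mem_at_restrict in Hv as [_ [t [s (Hxt & _ & Hs & Hv)]]].
        specialize (H t Hxt s Hs).
        destruct Hv as [->|[_ Hv]]; [exact H|].
        exact (forces_persistent M p _ _ Hv H).
  - split.
    + intros H u Hu a Ha.
      destruct (H (u, snd x)) with (a := cone_nbhd a (u, snd x)) as [v [Hv Hp]].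
      * split; simpl; auto.
      * split; [exists a, (u, snd x); auto|].
        apply dom_restrict, (ord_refl _ _ counted_le_order).
      * exists (fst v); split; [|apply IHp; exact Hp].
        exact (mem_at_cone_nbhd_apex _ _ _ Hv).
    + intros H y [Hxy _] b [[a [r [[Ha Hdom] ->]]] Hy].
      apply dom_restrict in Hy.
      destruct (H (fst y) Hxy a) as [v [Hv Hp]].
      * split; [exact Ha | exact (@nbhds_ok M a Ha _ _ (proj1 Hy) Hdom)].
      * exists (v, 0); split; [|apply IHp; exact Hp].
        exact (mem_at_cone_nbhd _ _ _ (v, 0) Hy Hv).
Qed.

End Unravelling.

Theorem theorem3p14 (Gamma : Ensemble formula) (phi : formula) :
  inm_conseq Gamma phi <-> coh_conseq Gamma phi.
Proof.
  split; intros H M C w HGamma.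
  - exact (H M I w HGamma).
  - apply (forces_unravelling M phi (w, 0)).
    apply (H (unravelling M) (unravelling_coherent M)).
    intros psi Hpsi; apply forces_unravelling; exact (HGamma psi Hpsi).
Qed.
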